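(* Let $\mathbb{X}$ be a two-dimensional real Banach space, let $x, y \in S_{\mathbb{X}}$ and let $\lambda\in(0,1)$. If $x \perp_{I} \left(\frac{1-\lambda}{\lambda}\right) y$, then $\beta(\lambda, x) = \|\lambda x + (1 - \lambda)y\| = \|\lambda x - (1 - \lambda)y\|$.
   Context: $S_{\mathbb{X}}$ is the unit sphere of $\mathbb{X}$. Isosceles orthogonality: $x\perp_I y$ means $\|x+y\|=\|x-y\|$. For $\lambda\in(0,1)$ and $x\in S_{\mathbb{X}}$, the generalized local James constant is $\beta(\lambda, x) = \sup\{\min\{\|\lambda x+(1-\lambda)y\|, \|\lambda x - (1-\lambda)y\|\} : y \in S_{\mathbb{X}}\}$. *)

(* Defs.v *)
From HB Require Import structures.
From mathcomp Require Import all_boot all_order all_algebra.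
From mathcomp Require Import all_classical all_reals all_analysis.
Set Implicit Arguments.
Unset Strict Implicit.
Unset Printing Implicit Defensive.
Import Order.TTheory GRing.Theory Num.Theory.
Import numFieldNormedType.Exports.
Local Open Scope classical_set_scope.
Local Open Scope ring_scope.

(* A join of the two hierarchies: the norm and the finite basis concern the same
   R-module structure. *)
#[short(type="finDimBanachType")]
HB.structure Definition FinDimBanach (R : realType) :=
  {X of CompleteNormedModule R X & Vector R X}.

Definition unit_sphere (R : realType) (X : normedModType R) : set X :=
  [set x | `|x| = 1].
Arguments unit_sphere {R} X.

Definition isosceles_orthogonal (R : realType) (X : normedModType R) (x y : X)
  : Prop := `|x + y| = `|x - y|.

(* sup is a junk 0 on empty or unbounded sets, but this set is bounded, and
   nonempty as soon as the unit sphere is. *)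
Definition gen_local_James (R : realType) (X : normedModType R) (lambda : R)
  (x : X) : R :=
  sup [set Num.min `|lambda *: x + (1 - lambda) *: y|
                   `|lambda *: x - (1 - lambda) *: y|
      | y in unit_sphere X].

(* Main.v *)
Require Import Defs.
From mathcomp Require Import all_boot all_order all_algebra.
From mathcomp Require Import all_classical all_reals all_analysis.
From mathcomp Require Import ring lra.
Import Order.TTheory GRing.Theory Num.Theory.
Import numFieldNormedType.Exports.
Local Open Scope classical_set_scope.
Local Open Scope ring_scope.

(** Put t = (1 - lambda) / lambda.  As the unit vector z moves along the unit
    circle from y to -x, the length of x + t z does not increase; symmetrically,
    that of x - t z does not increase as z moves from y to x.  Since x and y span
    the plane, z or -z lies on one of these two arcs, so one of x + t z, x - t z
    is not longer than the common length of x + t y and x - t y. *)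

(* With D = a t + b, the point (t/D) z is where the ray through z meets the
   segment from -x to t y, and it divides this segment in the ratio b : a t; the
   triangle inequality through this point is written here scaled by D. *)
Lemma norm_arc_monotone (R : realType) (X : normedModType R) (x y z : X)
    (a b t : R) :
  `|y| = 1 -> `|z| = 1 -> 0 <= a -> 0 <= b -> 0 < t ->
  z = b *: y - a *: x -> `|x + t *: z| <= `|x + t *: y|.
Proof.
move=> ny nz a0 b0 t0 ez.
pose D := a * t + b.
have D0 : 0 < D.
  rewrite lt_neqAle addr_ge0 ?mulr_ge0 ?(ltW t0)// andbT eq_sym.
  apply/eqP => /eqP; rewrite paddr_eq0 ?mulr_ge0 ?(ltW t0)//.
  rewrite mulf_eq0 (gt_eqF t0) orbF => /andP[/eqP a00 /eqP b00].
  by move: nz; rewrite ez a00 b00 !scale0r subrr normr0 => /eqP; rewrite eq_sym oner_eq0.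
have split_at_meet : D *: (x + t *: z) = b *: (x + t *: y) + (t * (D - 1)) *: z.
  have -> : D *: (x + t *: z) = D *: x + t *: z + (t * (D - 1)) *: z.
    by rewrite scalerDr -addrA -scalerDl scalerA; congr (_ + _ *: _); ring.
  congr (_ + _); rewrite ez scalerBr scalerDr !scalerA addrCA [RHS]addrC (mulrC b).
  by congr (_ + _); rewrite -scalerBl; congr (_ *: _); rewrite /D; ring.
have other_part : t *: (z - D *: y) = - ((a * t) *: (x + t *: y)).
  rewrite ez addrAC -scalerBl.
  have -> : b - D = - (a * t) by rewrite /D; ring.
  rewrite scalerBr !scalerA scalerDr scalerA opprD mulrN scaleNr addrC.
  by congr (- (_ *: _) - _ *: _); ring.
(* The lengths of [z] and [D *: y] are 1 and [D], so the reverse triangle inequality bounds their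
   gap by the length of [z - D *: y]. *)
have le1 : t * `|D - 1| <= a * t * `|x + t *: y|.
  have -> : a * t * `|x + t *: y| = `|t *: (z - D *: y)|.
    by rewrite other_part normrN normrZ ger0_norm// mulr_ge0// ltW.
  rewrite normrZ (gtr0_norm t0) ler_pM2l// distrC.
  by apply: le_trans (ler_dist_dist _ _); rewrite normrZ ny nz mulr1 (gtr0_norm D0).
rewrite -(ler_pM2l D0) -{1}(gtr0_norm D0) -normrZ split_at_meet.
rewrite (le_trans (ler_normD _ _))// !normrZ nz mulr1.
by rewrite (ger0_norm b0) (gtr0_norm t0) [leRHS]mulrDl addrC lerD2r.
Qed.

Lemma dim2_free_decomp (K : fieldType) (V : vectType K) (x y : V) :
  \dim (fullv : {vspace V}) = 2%N -> free [:: x; y] ->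
  forall z, exists a b : K, z = a *: x + b *: y.
Proof.
move=> dim2 fxy z.
have /vspaceP/(_ z) : <<[:: x; y]>>%VS = fullv.
  by apply/eqP; rewrite eqEdim subvf dim2 (eqP fxy).
rewrite memvf span_cons span_seq1 => /memv_addP[u /vlineP[a ->] [v /vlineP[b ->] ->]].
by exists a, b.
Qed.

(** If [x = c *: y], orthogonality reads |c + t| = |c - t|, which forces [t = 0] or [c = 0]. *)
Lemma isosceles_free (R : realType) (X : finDimBanachType R) (x y : X) (t : R) :
  `|x| = 1 -> `|y| = 1 -> 0 < t -> isosceles_orthogonal x (t *: y) ->
  free [:: x; y].
Proof.
move=> nx ny t0 oxy; rewrite free_cons span_seq1 seq1_free.
rewrite -normr_eq0 ny oner_eq0 andbT; apply/negP => /vlineP[c xE].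
move: oxy nx; rewrite /isosceles_orthogonal xE -scalerDl -scalerBl !normrZ ny !mulr1.
move=> /eqP; rewrite eqr_norm2 => /orP[] /eqP e nc.
  have t00 : t = 0 by lra.
  by rewrite t00 ltxx in t0.
have c0 : c = 0 by lra.
by move: nc; rewrite c0 normr0 => /eqP; rewrite eq_sym oner_eq0.
Qed.

Lemma isosceles_min_le (R : realType) (X : finDimBanachType R)
    (hdim : \dim (fullv : {vspace X}) = 2%N) (x y z : X) (t : R) :
  `|x| = 1 -> `|y| = 1 -> `|z| = 1 -> 0 < t ->
  isosceles_orthogonal x (t *: y) ->
  Num.min `|x + t *: z| `|x - t *: z| <= `|x + t *: y|.
Proof.
move=> nx ny + t0 oxy.
have [a [b]] := dim2_free_decomp _ _ _ _ hdim (isosceles_free _ _ _ _ _ nx ny t0 oxy) z.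
(* Replacing [z] by [- z] swaps the two terms of the minimum. *)
wlog b0 : z a b / 0 <= b.
  move=> th zE nz; have [b0|/ltW b0] := leP 0 b; first exact: (th z a b).
  rewrite minC -[in X in Num.min _ X](opprK z) -scalerN [t *: - - z]scalerN.
  apply: (th (- z) (- a) (- b)); rewrite ?oppr_ge0 ?normrN//.
  by rewrite zE opprD !scaleNr.
move=> zE nz; rewrite ge_min; apply/orP.
(* The sign of [a] tells the arc: from [y] to [x] if [a] is nonnegative, where monotonicity is
   applied with [- x] for [x]; otherwise from [y] to [- x]. *)
have [a0|/ltW a0] := leP 0 a; [right|left].
  rewrite oxy -normrN -[leRHS]normrN !opprB !(addrC (t *: _)).
  apply: (norm_arc_monotone _ _ _ _ _ a b) => //.
  by rewrite scalerN opprK addrC.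
apply: (norm_arc_monotone _ _ _ _ _ (- a) b) => //; first by rewrite oppr_ge0.
by rewrite scaleNr opprK addrC.
Qed.

Theorem proposition2p1 (R : realType) (X : finDimBanachType R)
  (hdim : \dim (fullv : {vspace X}) = 2%N)
  (x y : X) (hx : x \in unit_sphere X) (hy : y \in unit_sphere X)
  (lambda : R) (hlambda : 0 < lambda < 1)
  (hxy : isosceles_orthogonal x (((1 - lambda) / lambda) *: y)) :
  gen_local_James lambda x = `|lambda *: x + (1 - lambda) *: y| /\
  `|lambda *: x + (1 - lambda) *: y| = `|lambda *: x - (1 - lambda) *: y|.
Proof.
move: hx hy hlambda => /set_mem/= nx /set_mem/= ny /andP[l0 l1].
set t := (1 - lambda) / lambda in hxy.
have t0 : 0 < t by rewrite divr_gt0// subr_gt0.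
(* Pulling out the factor [lambda] leaves the vectors [x + t *: w] and [x - t *: w]. *)
have tE : 1 - lambda = lambda * t by rewrite mulrC divfK// gt_eqF.
have addE w : `|lambda *: x + (1 - lambda) *: w| = lambda * `|x + t *: w|.
  by rewrite tE -scalerA -scalerDr normrZ gtr0_norm.
have subE w : `|lambda *: x - (1 - lambda) *: w| = lambda * `|x - t *: w|.
  by rewrite tE -scalerA -scalerBr normrZ gtr0_norm.
have eqy : `|lambda *: x + (1 - lambda) *: y| = `|lambda *: x - (1 - lambda) *: y|.
  by rewrite addE subE hxy.
split=> //; apply/eqP; rewrite eq_le; apply/andP; split.
  apply: ge_sup => [|_ [w nw <-]]; first by eexists; exists y.
  rewrite !addE subE -minr_pMr ?(ltW l0)// ler_pM2l//.
  exact: isosceles_min_le.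
(* The value is attained at [y]; for [sup] to dominate it the set must be bounded above, which the
   same estimate provides. *)
apply: ub_le_sup; last by exists y => //; rewrite -eqy minxx.
exists (lambda * `|x + t *: y|) => _ [w nw <-].
rewrite addE subE -minr_pMr ?(ltW l0)// ler_pM2l//.
exact: isosceles_min_le.
Qed.
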